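(* Define $F:[0,1]\to[0,1]$ by $$F(x):=\inf\{y\in[0,1] : \exists\, \xi>0 \text{ such that } x\le \{\xi 2^n\}\le y \text{ for all } n\ge 0\},$$ where $\{z\}$ is the fractional part of $z$. Let $x\in[0,1]$. (i) If $x>\frac12$, then $F(x)=1$. (ii) If $x=0$, then $F(x)=0$. (iii) If $x\le\frac12$ and the base $2$ expansion of $2x$ is given by a characteristic Sturmian sequence, then $F(x)=x+\frac12$. Furthermore, $F(x)$ is the unique real number in $[0,1]$ that has a Sturmian base $2$ expansion and satisfies $x\le\{F(x)2^k\}\le F(x)$ for all $k\ge0$. (iv) If $x\le\frac12$ and the base $2$ expansion of $2x$ is given by a characteristic periodic balanced sequence of slope $p/q\in(0,1)$ with $\gcd(p,q)=1$, then $F(x)=r\big((1w_{p,q}0)^\infty\big)$, i.e. $F(x)$ is the rational number whose base $2$ expansion is the periodic balanced sequence $\boldsymbol{s}'_{p/q,0}=(1w_{p,q}0)^\infty$; in this case $F(x)\le x+\frac12$. (v) In all other cases (i.e. $0<x\le\frac12$ and the base $2$ expansion of $2x$ is neither a characteristic Sturmian sequence nor a characteristic periodic balanced sequence of slope in $(0,1)$), $F(x)$ is the rational number $r\big((1w_{p,q}0)^\infty\big)$, where $p,q$ is the unique pair of coprime integers with $0<p<q$ such that $r((w_{p,q}01)^\infty)<2x<r((w_{p,q}10)^\infty)$; in these cases $F(x)<x+\frac12$. Moreover, in cases (iv) and (v), $F(x)$ is the unique real number in $(0,1)$ whose base $2$ expansion is given by a periodic balanced sequence and which satisfies $x\le\{F(x)2^k\}\le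 F(x)$ for all $k\ge0$.
   Context: For a sequence $\boldsymbol{s}=(s_n)_{n\ge0}\in\{0,1\}^{\mathbb N}$, $r(\boldsymbol{s}):=\sum_{n\ge0}s_n2^{-(n+1)}$ is the real number whose sequence of base $2$ digits is $\boldsymbol{s}$. For real $\alpha,\rho\in[0,1]$ define $\boldsymbol{s}_{\alpha,\rho}(n)=\lfloor(n+1)\alpha+\rho\rfloor-\lfloor n\alpha+\rho\rfloor$ and $\boldsymbol{s}'_{\alpha,\rho}(n)=\lceil(n+1)\alpha+\rho\rceil-\lceil n\alpha+\rho\rceil$ ($n\ge0$). These are called Sturmian sequences (of slope $\alpha$) if $\alpha$ is irrational and periodic balanced sequences if $\alpha$ is rational; when $\alpha=\rho$ they are called characteristic. For irrational $\alpha$, $\boldsymbol{s}_{\alpha,\alpha}=\boldsymbol{s}'_{\alpha,\alpha}$. For coprime integers $0<p<q$ there is a unique word $w_{p,q}\in\{0,1\}^*$ of length $q-2$ (the central word of slope $p/q$) with $\boldsymbol{s}_{p/q,0}=(0w_{p,q}1)^\infty$ and $\boldsymbol{s}'_{p/q,0}=(1w_{p,q}0)^\infty$; the two characteristic periodic balanced sequences of slope $p/q$ are $(w_{p,q}10)^\infty$ and $(w_{p,q}01)^\infty$. Here $v^\infty=vvv\cdots$.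
   Formalization: Case (v) is stated for 0<x<1/2, with F(1/2)=1 stated separately (no pair p,q exists at x=1/2); the uniqueness in (iii), (iv), (v), false as written (for x=1/6 both 2/3 and 6/7 qualify), is asserted only among numbers z with z ≤ x+1/2. *)

(* Defs.v *)
From mathcomp Require Import all_boot all_order all_algebra.
From mathcomp Require Import zify.
From mathcomp Require Import all_classical all_reals all_analysis.

Set Implicit Arguments.
Unset Strict Implicit.
Unset Printing Implicit Defensive.

Import Order.TTheory GRing.Theory Num.Theory.
Import numFieldNormedType.Exports.

Local Open Scope classical_set_scope.
Local Open Scope ring_scope.

Section Distribution.
Context {R : realType}.
Implicit Types x y z xi : R.

Definition fracpart z : R := z - (Num.floor z)%:~R.

Definition admissible x : set R :=
  [set y | 0 <= y <= 1 /\
     exists2 xi, 0 < xi & forall n : nat, x <= fracpart (xi * 2 ^+ n) <= y].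

(* The infimum is taken in the ordered set [0, 1]: the infimum of the empty set
   is 1, whereas the library's real-valued [inf] of the empty set is 0. *)
Definition F x : R :=
  if pselect (admissible x !=set0) then inf (admissible x) else 1.

Definition orbit_between x z : Prop :=
  forall k : nat, x <= fracpart (z * 2 ^+ k) <= z.

End Distribution.

(* Sequences in {0,1}^N and words in {0,1}^* have type [nat -> int] and
   [seq int], so that digits are literally differences of floors or ceilings. *)

Section Sequences.
Context {R : realType}.
Implicit Types (z alpha rho : R) (s : nat -> int).

Definition r s : R := limn (series (fun n => (s n)%:~R / 2 ^+ n.+1 : R)).

Definition expansion_in (P : (nat -> int) -> Prop) z : Prop :=
  exists2 s, P s & z = r s.

Definition lower alpha rho (n : nat) : int :=
  Num.floor (n.+1%:R * alpha + rho) - Num.floor (n%:R * alpha + rho).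

Definition upper alpha rho (n : nat) : int :=
  Num.ceil (n.+1%:R * alpha + rho) - Num.ceil (n%:R * alpha + rho).

Definition balanced alpha rho s : Prop :=
  s = lower alpha rho \/ s = upper alpha rho.

End Sequences.

Section Classes.
Variable R : realType.
Implicit Types (s : nat -> int) (w : seq int) (p q : nat).

Definition sturmian s : Prop :=
  exists alpha rho : R, [/\ 0 <= alpha <= 1, 0 <= rho <= 1,
                            irrational alpha & balanced alpha rho s].

Definition periodic_balanced s : Prop :=
  exists alpha rho : R, [/\ 0 <= alpha <= 1, 0 <= rho <= 1,
                            rational alpha & balanced alpha rho s].

Definition char_sturmian s : Prop :=
  exists alpha : R, [/\ 0 <= alpha <= 1, irrational alpha
                      & balanced alpha alpha s].

Definition char_periodic_balanced p q s : Prop :=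
  balanced (p%:R / q%:R : R) (p%:R / q%:R) s.

Definition coprime_slope p q : Prop := (0 < p < q)%N /\ coprime p q.

Definition word_omega w : nat -> int := fun n => nth 0 w (n %% size w).

Definition is_central_word p q w : Prop :=
  [/\ size w = (q - 2)%N, {subset w <= [:: 0; 1]},
      lower (p%:R / q%:R : R) 0 = word_omega (0 :: w ++ [:: 1])
    & upper (p%:R / q%:R : R) 0 = word_omega (1 :: w ++ [:: 0])].

(* The word w_{p,q}; see [central_word_unique]. *)
Definition central_word p q : seq int := xget [::] (is_central_word p q).

End Classes.

Section CentralWord.
Variables (R : realType) (p q : nat).
Hypothesis pq : coprime_slope p q.

Let p_gt0 : (0 < p)%N. Proof. by case: pq => /andP[]. Qed.
Let p_ltq : (p < q)%N. Proof. by case: pq => /andP[]. Qed.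
Let q_gt0 : (0 < q)%N. Proof. exact: ltn_trans p_ltq. Qed.

Let fl (n : nat) := (n * p %/ q)%N.
Let cl (n : nat) := ((n * p + q.-1) %/ q)%N.

Let floorE n : Num.floor (n%:R * (p%:R / q%:R) + 0 : R) = fl n.
Proof.
have q0 : (0 : R) < q%:R by rewrite ltr0n.
apply: floor_def; rewrite addr0 mulrA -natrM ler_pdivlMr// ltr_pdivrMr//.
rewrite rmorphD/= -!pmulrn natr1 -!natrM ler_nat ltr_nat.
by rewrite leq_divM/= -ltn_divLR.
Qed.

Let ceilE n : Num.ceil (n%:R * (p%:R / q%:R) + 0 : R) = cl n.
Proof.
have q0 : (0 : R) < q%:R by rewrite ltr0n.
apply: ceil_def; rewrite addr0 mulrA -natrM ltr_pdivlMr// ler_pdivrMr//.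
have := divn_eq (n * p + q.-1) q; have := ltn_pmod (n * p + q.-1) q_gt0.
rewrite -/(cl n) => h1 h2.
rewrite rmorphB/= -pmulrn mulrBl mul1r ltrBlDr -natrD -!natrM ltr_nat ler_nat.
by move: h1 h2 p_ltq; clear; lia.
Qed.

Let lowerE n : lower (p%:R / q%:R : R) 0 n = (fl n.+1)%:Z - (fl n)%:Z.
Proof. by rewrite /lower !floorE. Qed.

Let upperE n : upper (p%:R / q%:R : R) 0 n = (cl n.+1)%:Z - (cl n)%:Z.
Proof. by rewrite /upper !ceilE. Qed.

Let flD k m : fl (k * q + m) = (k * p + fl m)%N.
Proof. by rewrite /fl mulnDl mulnAC divnMDl. Qed.

Let clD k m : cl (k * q + m) = (k * p + cl m)%N.
Proof. by rewrite /cl mulnDl mulnAC -addnA divnMDl. Qed.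

Let cl_fl m : (0 < m < q)%N -> cl m = (fl m).+1.
Proof.
move=> /andP[m0 mq].
have nd : (m * p %% q != 0)%N.
  apply/negP => /eqP/eqP; rewrite -/(dvdn _ _) Gauss_dvdl.
    by move=> /(dvdn_leq m0); rewrite leqNgt mq.
  by rewrite coprime_sym; case: pq.
rewrite /cl /fl {1}(divn_eq (m * p) q) -addnA divnMDl// -addn1; congr addn.
have := ltn_pmod (m * p) q_gt0; set t := (_ %% _)%N in nd * => tq.
by apply/eqP; rewrite eqn_leq -ltnS ltn_divLR// leq_divRL//; lia.
Qed.

Let fl01 n : (fl n <= fl n.+1 <= (fl n).+1)%N.
Proof.
rewrite leq_div2r ?leq_mul2r ?leqnSn ?orbT//= -ltnS ltn_divLR// mulSn.
have := divn_eq (n * p) q; have := ltn_pmod (n * p) q_gt0.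
by rewrite -/(fl n); lia.
Qed.

Lemma central_word_unique : exists! w, is_central_word R p q w.
Proof.
have e0 : forall f : nat -> nat, f = fl \/ f = cl -> f 0%N = 0%N.
  move=> f [] ->; first by rewrite /fl mul0n div0n.
  by rewrite /cl mul0n add0n divn_small// prednK.
have fl0 := e0 _ (or_introl erefl); have cl0 := e0 _ (or_intror erefl).
have flq : fl q = p by rewrite -[q]addn0 -[in LHS](mul1n q) flD fl0 mul1n addn0.
have clq : cl q = p by rewrite -[q]addn0 -[in LHS](mul1n q) clD cl0 mul1n addn0.
have fl1 : fl 1 = 0%N by rewrite /fl mul1n divn_small.
have q2 : (2 <= q)%N by exact: leq_ltn_trans p_ltq.
have cl1 : cl 1 = 1%N by rewrite cl_fl ?fl1// q2.
have clq1 : cl q.-1 = (fl q.-1).+1 by rewrite cl_fl//; move: q2; clear; lia.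
have flq1 : (fl q.-1).+1 = p.
  apply/eqP; rewrite eqn_leq; apply/andP; split.
    rewrite -clq1 -clq /cl leq_div2r// leq_add2r leq_mul2r leq_pred orbT//.
  by have := fl01 q.-1; rewrite prednK// flq => /andP[].
have per (f : nat -> nat) n : f = fl \/ f = cl ->
    (f n.+1)%:Z - (f n)%:Z = (f (n %% q).+1)%:Z - (f (n %% q)%N)%:Z.
  move=> ff; rewrite {1 2}(divn_eq n q) -addnS.
  by case: ff => ->; rewrite ?flD ?clD; lia.
pose w := mkseq (fun i => (fl i.+2)%:Z - (fl i.+1)%:Z) (q - 2).
have sz a b : size (a :: w ++ [:: b]) = q.
  by rewrite /= size_cat size_mkseq/=; move: q2; clear; lia.
exists w; split.
  split.
  - by rewrite size_mkseq.
  - move=> _ /mapP[i _ ->]; rewrite !inE; have := fl01 i.+1; lia.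
  - apply/funext => n; rewrite lowerE (per fl)//; last by left.
    rewrite /word_omega sz; have := ltn_pmod n q_gt0.
    case: (n %% q)%N => [_|m mq]; first by rewrite fl0 fl1.
    rewrite /= nth_cat size_mkseq; case: ifPn => hm.
      by rewrite nth_mkseq.
    have -> : m.+1 = q.-1 by move: hm mq; clear; lia.
    have -> : (m - (q - 2) = 0)%N by move: hm mq; clear; lia.
    by rewrite prednK// flq /=; move: flq1; clear; lia.
  - apply/funext => n; rewrite upperE (per cl)//; last by right.
    rewrite /word_omega sz; have := ltn_pmod n q_gt0.
    case: (n %% q)%N => [_|m mq]; first by rewrite cl0 cl1.
    rewrite /= nth_cat size_mkseq; case: ifPn => hm.
      by rewrite nth_mkseq// !cl_fl//; move: hm mq; clear; lia.
    have -> : m.+1 = q.-1 by move: hm mq; clear; lia.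
    have -> : (m - (q - 2) = 0)%N by move: hm mq; clear; lia.
    by rewrite prednK// clq clq1 /=; move: flq1; clear; lia.
move=> v [szv _ hv _]; apply: (@eq_from_nth _ 0); first by rewrite szv size_mkseq.
move=> i; rewrite size_mkseq => iq; rewrite nth_mkseq// -lowerE hv /word_omega.
have -> : size (0 :: v ++ [:: 1]) = q.
  by rewrite /= size_cat szv/=; move: q2; clear; lia.
rewrite modn_small; last by move: iq; clear; lia.
by rewrite /= nth_cat szv iq.
Qed.

Lemma central_wordP : is_central_word R p q (central_word R p q).
Proof. by apply: xgetPex; have [w [wP _]] := central_word_unique; exists w. Qed.

End CentralWord.

(* Main.v *)
Require Import Defs.
From mathcomp Require Import all_boot all_order all_algebra.
From mathcomp Require Import zify ring lra.
From mathcomp Require Import all_classical all_reals all_analysis.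

Set Implicit Arguments.
Unset Strict Implicit.
Unset Printing Implicit Defensive.

Import Order.TTheory GRing.Theory Num.Theory.
Import numFieldNormedType.Exports.

Local Open Scope classical_set_scope.
Local Open Scope ring_scope.

(** By Abel summation the value of a sequence of differences c(n+1) - c(n) is
    r(c) - c(0), so r(s_{a,0}) = L(a) := r(n |-> floor(n a)) and
    r(s'_{a,0}) = U(a) := r(n |-> ceil(n a)). Since floor(n a) <= ceil(n b) - 1
    for a < b and n > 0, the intervals [U(a) - 1/2, L(a)] are pairwise disjoint;
    by one-sided continuity of L they cover (0, 1/2), and they are reduced to a
    point exactly when a is irrational. On each of them F is constantly U(a).
    The orbit of U(a) stays in [L(a), U(a)], which gives F <= U(a). Conversely,
    an orbit in [x, y] with y < U(a) <= x + 1/2 has width less than 1/2, so its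
    points are ordered like their digit sums over windows of any length; if all
    windows of some length m had sum less than m a, the smallest points would be
    at most L(b) for some b < a, whence x <= L(b) < U(a) - 1/2. So for each M
    some orbit point has window sums at least ceil(m a) for all m < M, and
    y >= U(a). *)

(** * Integer sequences of at most linear growth *)

(** [r] is applied not only to digits but also to their partial sums, such as floor(n a). Linear
    growth makes these series converge and is stable under shifts. *)
Definition linear_growth (s : nat -> int) : Prop :=
  exists C : nat, forall n : nat, `|s n| <= (C * n.+1)%:Z.

Lemma linear_growthD s t : linear_growth s -> linear_growth t ->
  linear_growth (fun n => s n + t n).
Proof.
move=> [C hC] [D hD]; exists (C + D)%N => n.
by have := hC n; have := hD n; nia.
Qed.

Lemma linear_growthN s : linear_growth s -> linear_growth (fun n => - s n).
Proof. by move=> [C hC]; exists C => n; rewrite normrN. Qed.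

Lemma linear_growth_cst (c : int) : linear_growth (fun=> c).
Proof. by exists `|c|%N => n; nia. Qed.

Lemma linear_growthB s t : linear_growth s -> linear_growth t ->
  linear_growth (fun n => s n - t n).
Proof. by move=> hs ht; apply: linear_growthD => //; exact: linear_growthN. Qed.

Lemma linear_growth_shift k s : linear_growth s ->
  linear_growth (fun n => s (n + k)%N).
Proof.
move=> [C hC]; exists (C * k.+1)%N => n.
by have := hC (n + k)%N; nia.
Qed.

Lemma linear_growth_shift1 s : linear_growth s -> linear_growth (fun n => s n.+1).
Proof.
move=> [C hC]; exists (2 * C)%N => n.
by have := hC n.+1; nia.
Qed.

(** * Base 2 values of integer sequences *)

Section BinaryValue.
Variable R : realType.
Implicit Types (s t c : nat -> int) (x y : R).

Local Notation term s := (fun n => (s n)%:~R / 2 ^+ n.+1 : R).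

(** Comparison with a geometric series of ratio 3/4, because n + 1 <= 2 (3/2)^n. *)
Lemma cvg_linear_growth s : linear_growth s -> cvgn (series (term s)).
Proof.
move=> [C hC]; apply: normed_cvg.
have g : cvgn (series (geometric (C%:R : R) (3 / 4))).
  by apply: is_cvg_geometric_series; rewrite ger0_norm; lra.
apply: series_le_cvg g => n //=.
have le34 : n.+1%:R <= 2 * (3 / 2) ^+ n :> R.
  (* Two base cases: the ratio (n+2)/(n+1) is at most 3/2 only from n = 1 on. *)
  elim: n => [|[|n] IH]; first by rewrite expr0; lra.
    by rewrite expr1; lra.
  have n0 : (0 : R) <= n%:R by [].
  by move: IH; rewrite (exprS _ n.+1) -(addn3 n) -(addn2 n) !natrD; lra.
rewrite normrM normfV (ger0_norm (exprn_ge0 _ _))//.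
rewrite ler_pdivrMr ?exprn_gt0//.
rewrite -intr_norm; apply: (@le_trans _ _ ((C * n.+1)%:Z%:~R)).
  by rewrite ler_int.
rewrite -pmulrn natrM -mulrA ler_wpM2l//.
rewrite exprS mulrCA -exprMn.
by have -> : 3 / 4 * 2 = 3 / 2 :> R by lra.
Qed.

Lemma r_add s t : linear_growth s -> linear_growth t ->
  r (fun n => s n + t n) = r s + r t :> R.
Proof.
move=> /cvg_linear_growth hs /cvg_linear_growth ht.
rewrite /r -lim_seriesD//; congr (limn (series _)); apply/funext => n /=.
by rewrite rmorphD/= mulrDl.
Qed.

Lemma r_opp s : linear_growth s -> r (fun n => - s n) = - r s :> R.
Proof.
move=> /cvg_linear_growth hs.
rewrite /r -lim_seriesN//; congr (limn (series _)); apply/funext => n /=.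
by rewrite rmorphN/= mulNr.
Qed.

Lemma r_sub s t : linear_growth s -> linear_growth t ->
  r (fun n => s n - t n) = r s - r t :> R.
Proof. by move=> hs ht; rewrite r_add ?r_opp//; exact: linear_growthN. Qed.

Lemma r_shift s : linear_growth s ->
  2 * r s = (s 0%N)%:~R + r (fun n => s n.+1) :> R.
Proof.
move=> hs; have hS := linear_growth_shift1 hs.
suff -> : r (fun n => s n.+1) = 2 * r s - (s 0%N)%:~R :> R by lra.
apply: cvg_lim => //.
have -> : series (term (fun n => s n.+1)) =
  (fun n => 2 * series (term s) n.+1 - (s 0%N)%:~R).
  apply/funext => n; rewrite !seriesEord/= big_ord_recl/= mulrDr mulr_sumr.
  rewrite expr1 mulrCA divff// mulr1 addrAC subrr add0r.
  apply: eq_bigr => i _; rewrite /bump/= add1n (exprS _ i.+1) invfM mulrCA.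
  by rewrite [2 * _]mulrA mulfV// mul1r.
apply: cvgB; last exact: cvg_cst.
apply: cvgMr.
have := cvg_linear_growth hs.
by rewrite -(cvg_shiftS (series (term s))).
Qed.

Lemma r_cst (c : int) : r (fun=> c) = c%:~R :> R.
Proof. by have := r_shift (linear_growth_cst c); lra. Qed.

Lemma r_eq s t : (forall n, s n = t n) -> r s = r t :> R.
Proof. by move=> /funext ->. Qed.

Lemma r_ge0 s : (forall n, 0 <= s n) -> linear_growth s -> 0 <= r s :> R.
Proof.
move=> s0 /cvg_linear_growth hs; apply: limr_ge => //.
apply: nearW => n; apply: sumr_ge0 => i _.
by rewrite mulr_ge0// ?ler0z// invr_ge0 exprn_ge0.
Qed.

Lemma r_gt0 s k : (forall n, 0 <= s n) -> 0 < s k -> linear_growth s ->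
  0 < r s :> R.
Proof.
elim: k s => [|k IH] s s0 sk hs; have /= := r_shift hs.
  have : 0 <= r (fun n => s n.+1) :> R.
    by apply: r_ge0 => // ; exact: linear_growth_shift1.
  by move: sk; rewrite -(ltr0z R); lra.
have := IH (fun n => s n.+1) (fun n => s0 n.+1) sk (linear_growth_shift1 hs).
by have := s0 0%N; rewrite -(ler0z R); lra.
Qed.

Lemma r_le s t : (forall n, s n <= t n) -> linear_growth s -> linear_growth t ->
  r s <= r t :> R.
Proof.
move=> st hs ht; rewrite -subr_ge0 -r_sub//.
by apply: r_ge0; [move=> n; rewrite subr_ge0 | exact: linear_growthB].
Qed.

Lemma r_lt s t k : (forall n, s n <= t n) -> s k < t k ->
  linear_growth s -> linear_growth t -> r s < r t :> R.
Proof.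
move=> st sk hs ht; rewrite -subr_gt0 -r_sub//.
by apply: (@r_gt0 _ k); [move=> n; rewrite subr_ge0 | rewrite subr_gt0 |
  exact: linear_growthB].
Qed.

Lemma linear_growth_affine (a b : nat) : linear_growth (fun n => (a * n + b)%:Z).
Proof. by exists (a + b)%N => n; nia. Qed.

(** Shifting adds [a] to every term, so the value X solves 2 X = b + (X + a). *)
Lemma r_affine (a b : nat) : r (fun n => (a * n + b)%:Z) = (a + b)%:R :> R.
Proof.
have := r_shift (linear_growth_affine a b); rewrite muln0 add0n.
have -> : r (fun n => (a * n.+1 + b)%:Z) =
    r (fun n => (a * n + b)%:Z) + a%:Z%:~R :> R.
  rewrite -(r_cst a) -r_add; last exact: linear_growth_cst.
    by apply: r_eq => n; lia.
  exact: linear_growth_affine.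
rewrite natrD -!pmulrn; lra.
Qed.

Lemma r_norm_le (C : nat) s : (forall n, `|s n| <= (C * n.+1)%:Z) ->
  `|r s| <= (2 * C)%:R :> R.
Proof.
move=> hC; have hs : linear_growth s by exists C.
have -> : (2 * C)%:R = r (fun n => (C * n + C)%:Z) :> R.
  by rewrite r_affine mul2n addnn.
have ha := linear_growth_affine C C.
rewrite ler_norml -r_opp//; apply/andP; split; apply: r_le => //.
- by move=> n; have := hC n; lia.
- exact: linear_growthN.
- by move=> n; have := hC n; lia.
Qed.

Lemma le0_of_exp_bound (C : nat) y :
  (forall M : nat, y * 2 ^+ M <= (C * M.+1)%:R) -> y <= 0.
Proof.
move=> h; rewrite leNgt; apply/negP => y0.
have lt2 (K : nat) : K.+1%:R <= 2 ^+ K :> R.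
  by rewrite -natrX ler_nat; exact: ltn_expl.
(* Take M = 2K: 2^(2K) is at least (K+1)^2, while C (2K+1) is at most 2C (K+1). *)
have key (K : nat) : y * K.+1%:R <= (2 * C)%:R.
  have K0 : (0 : R) < K.+1%:R by rewrite ltr0n.
  rewrite -(ler_pM2r K0) -mulrA.
  apply: (@le_trans _ _ (y * 2 ^+ (K + K)%N)).
    rewrite ler_wpM2l ?(ltW y0)// exprD.
    by apply: ler_pM => //; exact: ltW.
  by apply: (le_trans (h _)); rewrite -natrM ler_nat; nia.
have := key (Num.truncn ((2 * C)%:R / y)); rewrite leNgt => /negP; apply.
rewrite mulrC -ltr_pdivrMr//.
by have /andP[] := truncn_itv (divr_ge0 (ler0n R (2 * C)) (ltW y0)).
Qed.

(** Each doubling splits off one term s(m) - t(m) <= 0, and discarding it only increases the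
    difference. *)
Lemma r_shift_diff s t M : linear_growth s -> linear_growth t ->
  (forall m, (m < M)%N -> s m <= t m) ->
  (r s - r t) * 2 ^+ M <=
    r (fun n => s (n + M)%N) - r (fun n => t (n + M)%N) :> R.
Proof.
elim: M s t => [|M IH] s t hs ht st.
  rewrite expr0 mulr1; have e u : r (fun n => u (n + 0)%N) = r u :> R.
    by apply: r_eq => n; rewrite addn0.
  by rewrite !e.
have hs1 := linear_growth_shift1 hs; have ht1 := linear_growth_shift1 ht.
have := IH (fun n => s n.+1) (fun n => t n.+1) hs1 ht1 (fun m => st m.+1).
have e u : r (fun n => u (n + M).+1%N) = r (fun n => u (n + M.+1)%N) :> R.
  by apply: r_eq => n; rewrite addnS.
rewrite !e; apply: le_trans.
rewrite exprS mulrA ler_wpM2r ?exprn_ge0//.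
rewrite mulrC mulrBr !r_shift//.
by have := st 0%N isT; rewrite -(ler_int R); lra.
Qed.

(** One-sided continuity: M doublings multiply the deficit x - r c by 2^M, yet it stays bounded by
    two tails of size O(M). *)
Lemma le_r_lim (C : nat) c x : (forall n, `|c n| <= (C * n.+1)%:Z) ->
  (forall M : nat, exists s, [/\ forall n, `|s n| <= (C * n.+1)%:Z,
     forall m, (m < M)%N -> s m <= c m & x <= r s]) ->
  x <= r c.
Proof.
move=> hc h; rewrite -subr_le0; apply: (@le0_of_exp_bound (4 * C)%N) => M.
have [s [hs sc xs]] := h M.
have gs : linear_growth s by exists C.
have gc : linear_growth c by exists C.
apply: (@le_trans _ _ ((r s - r c) * 2 ^+ M)).
  by rewrite ler_wpM2r ?exprn_ge0// lerB.
apply: (le_trans (r_shift_diff gs gc sc)).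
have b u : (forall n, `|u n| <= (C * n.+1)%:Z) ->
    `|r (fun n => u (n + M)%N)| <= (2 * (C * M.+1))%:R :> R.
  by move=> hu; apply: r_norm_le => n; have := hu (n + M)%N; nia.
have := b _ hs; have := b _ hc; rewrite !ler_norml !natrM.
by move=> /andP[? ?] /andP[? ?]; lra.
Qed.

Lemma r_lim_le (C : nat) c x : (forall n, `|c n| <= (C * n.+1)%:Z) ->
  (forall M : nat, exists s, [/\ forall n, `|s n| <= (C * n.+1)%:Z,
     forall m, (m < M)%N -> c m <= s m & r s <= x]) ->
  r c <= x.
Proof.
move=> hc h; have gc : linear_growth c by exists C.
rewrite -lerN2 -r_opp//; apply: (@le_r_lim C).
  by move=> n; rewrite normrN.
move=> M; have [s [hs sc xs]] := h M; exists (fun n => - s n); split.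
- by move=> n; rewrite normrN.
- by move=> m mM; rewrite lerN2 sc.
- by rewrite r_opp ?lerN2//; exists C.
Qed.

(** The error [Y] doubles at each step but grows at most linearly, so it vanishes. *)
Lemma r_recurrence (C : nat) c (X : nat -> R) : linear_growth c ->
  (forall m, X m.+1 = 2 * X m - (c m)%:~R) ->
  (forall m, `|X m| <= (C * m.+1)%:R) -> r c = X 0%N.
Proof.
move=> [D hD] rec hX.
have gc k : linear_growth (fun n => c (n + k)%N).
  by apply: linear_growth_shift; exists D.
pose Y m := r (fun n => c (n + m)%N) - X m.
have YE m : Y m = Y 0%N * 2 ^+ m.
  elim: m => [|m IH]; first by rewrite expr0 mulr1.
  rewrite exprS mulrCA -IH /Y rec mulrBr r_shift//.
  rewrite (_ : r (fun n => c (n.+1 + m)%N) = r (fun n => c (n + m.+1)%N)).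
    by rewrite add0n; lra.
  by apply: r_eq => n; rewrite addnS.
have hY m : `|Y m| <= ((2 * D + C) * m.+1)%:R.
  apply: (le_trans (ler_normB _ _)); rewrite mulnDl natrD lerD//.
  by rewrite -mulnA; apply: r_norm_le => n; have := hD (n + m)%N; nia.
have Y0 : `|Y 0%N| <= 0.
  apply: (@le0_of_exp_bound (2 * D + C)) => M.
  by have := hY M; rewrite YE normrM (ger0_norm (exprn_ge0 _ _)).
move: Y0; rewrite normr_le0 /Y subr_eq0 => /eqP <-.
by apply: r_eq => n; rewrite addn0.
Qed.

Lemma r_difference c : linear_growth c ->
  r (fun n => c n.+1 - c n) = r c - (c 0%N)%:~R :> R.
Proof.
move=> hc; rewrite r_sub//; last exact: linear_growth_shift1.
by have := r_shift hc; lra.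
Qed.

Lemma fracpart_intD (n : int) y : 0 <= y < 1 -> fracpart (n%:~R + y) = y.
Proof.
move=> y01; rewrite /fracpart floorDzr; last by rewrite intr_int.
have -> : Num.floor y = 0 by apply: floor_def; rewrite add0r.
by rewrite intrKfloor addr0 addrAC subrr add0r.
Qed.

Lemma r_mul_exp2 s k : linear_growth s ->
  exists n : int, r s * 2 ^+ k = n%:~R + r (fun m => s (m + k)%N) :> R.
Proof.
elim: k s => [|k IH] s hs.
  by exists 0; rewrite expr0 mulr1 add0r; apply: r_eq => n; rewrite addn0.
have [n hn] := IH _ (linear_growth_shift1 hs).
exists (s 0%N * 2 ^+ k + n).
rewrite exprS mulrA (mulrC _ 2) r_shift// mulrDl hn rmorphD/= rmorphM rmorphXn/=.
rewrite -addrA; congr (_ + (_ + _)).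
by apply: r_eq => m; rewrite addnS.
Qed.

Lemma fracpart_r s k : linear_growth s ->
  0 <= (r (fun m => s (m + k)%N) : R) < 1 ->
  fracpart (r s * 2 ^+ k) = r (fun m => s (m + k)%N) :> R.
Proof. by move=> hs h; have [n ->] := r_mul_exp2 k hs; rewrite fracpart_intD. Qed.

End BinaryValue.

(** * The extremal values L(a) and U(a) of a slope *)

Section Slopes.
Variable R : realType.
Implicit Types (a b rho x y z : R).

Definition floor_mul a (m : nat) : int := Num.floor (m%:R * a).
Definition ceil_mul a (m : nat) : int := Num.ceil (m%:R * a).

(* [lower_value a] and [upper_value a] are the infimum and the supremum of the
   orbit of slope [a] under doubling: r((0w1)^oo) and r((1w0)^oo) if [a] is
   rational. *)
Definition lower_value a : R := r (floor_mul a).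
Definition upper_value a : R := r (ceil_mul a).

Lemma floor_bounds x :
  ((Num.floor x)%:~R : R) <= x < (Num.floor x)%:~R + 1.
Proof. by have := floor_itv x; rewrite rmorphD. Qed.

Lemma ceil_bounds x : ((Num.ceil x)%:~R : R) - 1 < x <= (Num.ceil x)%:~R.
Proof. by have := ceil_itv x; rewrite rmorphB. Qed.

Lemma le_of_lt_intD1 (m n : int) : (m%:~R : R) < n%:~R + 1 -> m <= n.
Proof. by rewrite -[1]/(1%:~R) -rmorphD/= ltr_int ltzD1. Qed.

Lemma norm_floor_mul a (m : nat) : 0 <= a <= 1 ->
  `|floor_mul a m| <= (1 * m.+1)%:Z.
Proof.
move=> a01; have /andP[h1 h2] := floor_bounds (m%:R * a).
have m0 : (0 : R) <= m%:R by []; have e : m.+1%:R = m%:R + 1 :> R by rewrite natr1.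
rewrite mul1n ger0_norm.
  by rewrite -(ler_int R) -pmulrn e /floor_mul; nra.
by apply: le_of_lt_intD1; rewrite /floor_mul; nra.
Qed.

Lemma norm_ceil_mul a (m : nat) : 0 <= a <= 1 ->
  `|ceil_mul a m| <= (1 * m.+1)%:Z.
Proof.
move=> a01; have /andP[h1 h2] := ceil_bounds (m%:R * a).
have m0 : (0 : R) <= m%:R by []; have e : m.+1%:R = m%:R + 1 :> R by rewrite natr1.
rewrite mul1n ger0_norm.
  by apply: le_of_lt_intD1; rewrite -pmulrn e /ceil_mul; nra.
by rewrite -(ler_int R) /ceil_mul; nra.
Qed.

Lemma growth_floor_mul a : 0 <= a <= 1 -> linear_growth (floor_mul a).
Proof. by move=> ha; exists 1%N => n; exact: norm_floor_mul. Qed.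

Lemma growth_ceil_mul a : 0 <= a <= 1 -> linear_growth (ceil_mul a).
Proof. by move=> ha; exists 1%N => n; exact: norm_ceil_mul. Qed.

Lemma floor_mul0 a : floor_mul a 0 = 0.
Proof. by rewrite /floor_mul mul0r floor0. Qed.

Lemma ceil_mul0 a : ceil_mul a 0 = 0.
Proof. by rewrite /ceil_mul mul0r ceil0. Qed.

Lemma lower0E a : lower a 0 = fun n => floor_mul a n.+1 - floor_mul a n.
Proof. by apply/funext => n; rewrite /lower /floor_mul !addr0. Qed.

Lemma upper0E a : upper a 0 = fun n => ceil_mul a n.+1 - ceil_mul a n.
Proof. by apply/funext => n; rewrite /upper /ceil_mul !addr0. Qed.

Lemma r_lower0 a : 0 <= a <= 1 -> r (lower a 0) = lower_value a.
Proof.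
move=> ha; rewrite lower0E r_difference ?floor_mul0 ?subr0//.
exact: growth_floor_mul.
Qed.

Lemma r_upper0 a : 0 <= a <= 1 -> r (upper a 0) = upper_value a.
Proof.
move=> ha; rewrite upper0E r_difference ?ceil_mul0 ?subr0//.
exact: growth_ceil_mul.
Qed.

Lemma lowerS a n : lower a 0 n.+1 = lower a a n.
Proof.
have e (m : nat) : m.+1%:R * a = m%:R * a + a by rewrite -natr1 mulrDl mul1r.
by rewrite /lower !addr0 (e n.+1) (e n).
Qed.

Lemma upperS a n : upper a 0 n.+1 = upper a a n.
Proof.
have e (m : nat) : m.+1%:R * a = m%:R * a + a by rewrite -natr1 mulrDl mul1r.
by rewrite /upper !addr0 (e n.+1) (e n).
Qed.

(** For a < 1 the sequence s_{a,0} begins with the digit 0, and dropping it leaves the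
    characteristic sequence. This value and that of [r_upper_char] are the ends of
    [2 U(a) - 1, 2 L(a)]. *)
Lemma r_lower_char a : 0 <= a < 1 -> r (lower a a) = 2 * lower_value a.
Proof.
move=> /andP[a0 a1]; have ha : 0 <= a <= 1 by rewrite a0 ltW.
have g : linear_growth (lower a 0).
  rewrite lower0E; apply: linear_growthB; last exact: growth_floor_mul.
  exact: linear_growth_shift1 (growth_floor_mul ha).
rewrite -r_lower0// r_shift//.
have -> : lower a 0 0 = 0.
  rewrite /lower mul0r mul1r !addr0 floor0 subr0.
  by apply: floor_def; rewrite add0r a0.
by rewrite add0r; apply: r_eq => n; rewrite lowerS.
Qed.

Lemma r_upper_char a : 0 < a <= 1 -> r (upper a a) = 2 * upper_value a - 1.
Proof.
move=> /andP[a0 a1]; have ha : 0 <= a <= 1 by rewrite a1 ltW.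
have g : linear_growth (upper a 0).
  rewrite upper0E; apply: linear_growthB; last exact: growth_ceil_mul.
  exact: linear_growth_shift1 (growth_ceil_mul ha).
rewrite -r_upper0// r_shift//.
have -> : upper a 0 0 = 1.
  rewrite /upper mul0r mul1r !addr0 ceil0 subr0.
  by apply: ceil_def; rewrite subrr a0.
by rewrite addrAC subrr add0r; apply: r_eq => n; rewrite upperS.
Qed.

Lemma growth_pos : linear_growth (fun n : nat => ((0 < n)%N : nat)%:Z).
Proof. by exists 1%N => n; lia. Qed.

Lemma r_pos : r (fun n : nat => ((0 < n)%N : nat)%:Z) = 2^-1 :> R.
Proof.
have := r_shift R growth_pos; rewrite /= mulr0z add0r.
by rewrite (r_cst R 1); lra.
Qed.

(** Subtracting 1/2 lowers every term except the one of index 0 by 1, which permits termwise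
    comparison with floors. *)
Lemma upper_value_sub_half a : 0 <= a <= 1 ->
  upper_value a - 2^-1 = r (fun n => ceil_mul a n - ((0 < n)%N : nat)%:Z).
Proof.
by move=> ha; rewrite r_sub ?r_pos//; [exact: growth_ceil_mul|exact: growth_pos].
Qed.

Lemma growth_ceil_pos a : 0 <= a <= 1 ->
  linear_growth (fun n => ceil_mul a n - ((0 < n)%N : nat)%:Z).
Proof.
by move=> ha; apply: linear_growthB; [exact: growth_ceil_mul|exact: growth_pos].
Qed.

Lemma upper_le_lower a : 0 <= a <= 1 -> upper_value a - 2^-1 <= lower_value a.
Proof.
move=> ha; rewrite upper_value_sub_half//; apply: r_le.
- case=> [|n]; first by rewrite floor_mul0 ceil_mul0.
  rewrite lerBlDr; apply: le_of_lt_intD1; rewrite rmorphD/=.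
  have := floor_bounds (n.+1%:R * a); have := ceil_bounds (n.+1%:R * a).
  by rewrite -/(floor_mul a n.+1) -/(ceil_mul a n.+1); lra.
- exact: growth_ceil_pos.
- exact: growth_floor_mul.
Qed.

(** No multiple m a with m > 0 is an integer, so ceil(m a) - 1 = floor(m a). *)
Lemma upper_eq_lower_irrational a : 0 <= a <= 1 -> irrational a ->
  upper_value a - 2^-1 = lower_value a.
Proof.
move=> ha ia; apply/eqP; rewrite eq_le upper_le_lower//= upper_value_sub_half//.
apply: r_le; [|exact: growth_floor_mul|exact: growth_ceil_pos].
case=> [|n]; first by rewrite floor_mul0 ceil_mul0.
rewrite -ltzD1 addrAC -addrA addr0 -(ltr_int R).
have := floor_bounds (n.+1%:R * a); have := ceil_bounds (n.+1%:R * a).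
rewrite -/(floor_mul a n.+1) -/(ceil_mul a n.+1).
move=> /andP[_ h1] /andP[h2 _]; rewrite lt_neqAle (le_trans h2 h1) andbT.
apply/negP => /eqP e; apply: ia; apply/rationalP.
exists (floor_mul a n.+1), n.+1.
have n0 : n.+1%:R != 0 :> R by rewrite pnatr_eq0.
apply: (mulfI n0); rewrite mulrCA divff// mulr1.
by apply/eqP; rewrite eq_le h2 e h1.
Qed.

Lemma lt_archimedean x y : 0 < x -> exists n : nat, y < n%:R * x.
Proof.
move=> x0; exists (Num.truncn (`|y| / x)).+1.
have /andP[_] := truncn_itv (divr_ge0 (normr_ge0 y) (ltW x0)).
by rewrite ltr_pdivrMr//; apply: le_lt_trans; exact: ler_norm.
Qed.

Lemma lower_lt_upper a b : 0 <= a -> a < b -> b <= 1 ->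
  lower_value a < upper_value b - 2^-1.
Proof.
move=> a0 ab b1.
have ha : 0 <= a <= 1 by apply/andP; split; lra.
have hb : 0 <= b <= 1 by apply/andP; split; lra.
(* An index with k a + 1 < k b makes the inequality floor(k a) <= ceil(k b) - 1 strict. *)
have [k hk] : exists k : nat, 1 < k%:R * (b - a).
  by apply: lt_archimedean; rewrite subr_gt0.
rewrite upper_value_sub_half//; apply: (@r_lt _ _ _ k).
- case=> [|n]; first by rewrite floor_mul0 ceil_mul0.
  rewrite lerBrDr lezD1 -(ltr_int R).
  have /andP[h1 _] := floor_bounds (n.+1%:R * a).
  have /andP[_ h2] := ceil_bounds (n.+1%:R * b).
  apply: (le_lt_trans h1); apply: lt_le_trans h2.
  by rewrite ltr_pM2l// ltr0n.
- have k0 : (0 < k)%N by rewrite lt0n; apply: contraTneq hk => ->; rewrite mul0r ltr10.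
  rewrite k0 ltrBrDr -(ltr_int R) rmorphD/=.
  have /andP[h1 _] := floor_bounds (k%:R * a).
  have /andP[_ h2] := ceil_bounds (k%:R * b).
  by rewrite /floor_mul /ceil_mul; move: h1 h2 hk; lra.
- exact: growth_floor_mul.
- exact: growth_ceil_pos.
Qed.

Lemma upper_value_mono a b : 0 <= a -> a <= b -> b <= 1 ->
  upper_value a <= upper_value b.
Proof.
move=> a0; rewrite le_eqVlt => /predU1P[->//|ab] b1.
have := lower_lt_upper a0 ab b1.
have : upper_value a - 2^-1 <= lower_value a.
  by apply: upper_le_lower; rewrite a0 (ltW (lt_le_trans ab b1)).
lra.
Qed.

Lemma lower_value0 : lower_value 0 = 0.
Proof.
rewrite -[RHS](r_cst R 0); apply: r_eq => n.
by rewrite /floor_mul mulr0 floor0.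
Qed.

Lemma lower_value1 : lower_value 1 = 1.
Proof.
transitivity (r (fun n => (1 * n + 0)%:Z) : R); last exact: r_affine.
apply: r_eq => n.
by rewrite /floor_mul mulr1 mul1n addn0 pmulrn intrKfloor.
Qed.

Lemma upper_value1 : upper_value 1 = 1.
Proof.
transitivity (r (fun n => (1 * n + 0)%:Z) : R); last exact: r_affine.
apply: r_eq => n.
by rewrite /ceil_mul mulr1 mul1n addn0 pmulrn intrKceil.
Qed.

Lemma upper_value_lt1 a : 0 <= a < 1 -> upper_value a < 1.
Proof.
move=> /andP[a0 a1].
have := lower_lt_upper a0 a1 (lexx 1); rewrite upper_value1.
have : upper_value a - 2^-1 <= lower_value a.
  by apply: upper_le_lower; rewrite a0 ltW.
lra.
Qed.

Lemma lower_value_ge0 a : 0 <= a <= 1 -> 0 <= lower_value a.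
Proof.
move=> ha; apply: r_ge0; last exact: growth_floor_mul.
move=> n; rewrite /floor_mul floor_ge0 mulr_ge0//.
by have /andP[] := ha.
Qed.

Lemma lower_le_upper_value a : 0 <= a <= 1 -> lower_value a <= upper_value a.
Proof.
move=> ha; apply: r_le; [|exact: growth_floor_mul|exact: growth_ceil_mul].
by move=> n; rewrite -(ler_int R); apply: (@le_trans _ _ (n%:R * a));
  [have /andP[] := floor_bounds (n%:R * a)|have /andP[] := ceil_bounds (n%:R * a)].
Qed.

Lemma upper_value_gt0 a : 0 < a <= 1 -> 0 < upper_value a.
Proof.
move=> /andP[a0 a1].
have := lower_lt_upper (lexx 0) a0 a1; rewrite lower_value0; lra.
Qed.

End Slopes.

(** * Orbits of balanced sequences *)

Section Rounding.
Variable R : realType.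
Implicit Types (a rho x y z : R) (g : R -> int) (c : nat -> int).

(** The properties shared by floor and ceiling; they let [lower] and [upper] be treated together. *)
Definition rounding g : Prop :=
  (forall y (n : int), g (y + n%:~R) = g y + n) /\ {homo g : x y / x <= y}.

Lemma rounding_floor : rounding (@Num.floor R).
Proof.
split=> [y n|]; last exact: le_floor.
by rewrite floorDrz ?intr_int// intrKfloor.
Qed.

Lemma rounding_ceil : rounding (@Num.ceil R).
Proof.
split=> [y n|]; last exact: le_ceil.
by rewrite ceilDrz ?intr_int// intrKceil.
Qed.

Definition rounded g a rho (n : nat) : int := g (n%:R * a + rho).

Lemma balanced_rounded a rho s : balanced a rho s ->
  exists2 g, rounding g & s = fun n => rounded g a rho n.+1 - rounded g a rho n.
Proof.
case=> ->; [exists (@Num.floor R)|exists (@Num.ceil R)] => //.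
  exact: rounding_floor.
exact: rounding_ceil.
Qed.

(** The middle term is the digit sum over [m] positions from [k] on. Adding m a to the argument of
    [g] is squeezed between adding its floor and adding its ceiling. *)
Lemma rounded_window g a rho (k m : nat) : rounding g ->
  floor_mul a m <= rounded g a rho (m + k) - rounded g a rho k <= ceil_mul a m.
Proof.
move=> [gD gle]; rewrite lerBrDl lerBlDl /rounded -!gD.
have /andP[h1 _] := floor_bounds (m%:R * a).
have /andP[_ h2] := ceil_bounds (m%:R * a).
rewrite natrD mulrDl; apply/andP; split; apply: gle.
  by rewrite /floor_mul; lra.
by rewrite /ceil_mul; lra.
Qed.

Lemma growth_window g a rho (k : nat) : rounding g -> 0 <= a <= 1 ->
  linear_growth (fun m => rounded g a rho (m + k)%N - rounded g a rho k).
Proof.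
move=> hg ha; exists 1%N => m; have := rounded_window a rho k m hg.
by have := norm_floor_mul m ha; have := norm_ceil_mul m ha; lia.
Qed.

Lemma growth_rounded g a rho : rounding g -> 0 <= a <= 1 ->
  linear_growth (rounded g a rho).
Proof.
move=> hg ha.
have := linear_growthD (growth_window rho 0 hg ha)
                       (linear_growth_cst (rounded g a rho 0)).
move=> [C hC]; exists C => n; have := hC n; rewrite addn0.
by rewrite subrK.
Qed.

Lemma r_window_shift c k : linear_growth c ->
  r (fun m => c (m + k).+1 - c (m + k)%N) = r (fun m => c (m + k)%N - c k) :> R.
Proof.
move=> hc; have hk := linear_growth_shift k hc.
have := r_difference R hk; rewrite /= add0n => ->.
by rewrite r_sub ?r_cst//; exact: linear_growth_cst.
Qed.

Lemma fracpart_window g a rho (k : nat) z : rounding g -> 0 <= a <= 1 ->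
  z = r (fun n => rounded g a rho n.+1 - rounded g a rho n) ->
  0 <= (r (fun m => rounded g a rho (m + k)%N - rounded g a rho k) : R) < 1 ->
  fracpart (z * 2 ^+ k) = r (fun m => rounded g a rho (m + k)%N - rounded g a rho k).
Proof.
move=> hg ha ->; have hc := growth_rounded rho hg ha.
rewrite -r_window_shift// => h01; rewrite fracpart_r//.
exact: linear_growthB (linear_growth_shift1 hc) hc.
Qed.

Lemma window_value_bounds g a rho (k : nat) : rounding g -> 0 <= a <= 1 ->
  lower_value a <= r (fun m => rounded g a rho (m + k)%N - rounded g a rho k)
                <= upper_value a.
Proof.
move=> hg ha; apply/andP; split; apply: r_le.
- by move=> m; have /andP[] := rounded_window a rho k m hg.
- exact: growth_floor_mul.
- exact: growth_window.
- by move=> m; have /andP[] := rounded_window a rho k m hg.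
- exact: growth_window.
- exact: growth_ceil_mul.
Qed.

Lemma orbit_upper_value a x : 0 <= a < 1 -> x <= lower_value a ->
  orbit_between x (upper_value a).
Proof.
move=> /[dup] ha1 /andP[a0 a1] xa k; have ha : 0 <= a <= 1 by rewrite a0 ltW.
have /andP[w1 w2] := window_value_bounds 0 k rounding_ceil ha.
rewrite (@fracpart_window _ a 0 k _ rounding_ceil ha).
- by rewrite (le_trans xa w1).
- by rewrite -r_upper0.
- rewrite (le_trans (lower_value_ge0 ha) w1)/=.
  exact: le_lt_trans (upper_value_lt1 ha1).
Qed.

Lemma rational_mul_int a : rational a ->
  exists (q : nat) (p : int), (0 < q)%N /\ q%:R * a = p%:~R.
Proof.
move=> /rationalP[P [[|q] aE]]; [exists 1%N, 0|exists q.+1, P]; split=> //.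
  by rewrite aE invr0 mulr0 mulr0.
by rewrite aE mulrCA divff ?pnatr_eq0// mulr1.
Qed.

(* For a rational slope the index [k] maximising the fractional part of the
   rounding starts a window that is maximal at every length. *)
Lemma rounded_max_window g a rho : rounding g -> rational a ->
  exists k : nat, forall m : nat,
    ceil_mul a m <= rounded g a rho (m + k) - rounded g a rho k.
Proof.
move=> [gD gle] /rational_mul_int[q [p [q_gt0 aE]]].
pose th (k : nat) := k%:R * a + rho - (rounded g a rho k)%:~R.
have thD k : th (k + q)%N = th k.
  have e : (k + q)%:R * a + rho = k%:R * a + rho + p%:~R.
    by rewrite natrD mulrDl aE; ring.
  by rewrite /th /rounded e gD rmorphD/=; ring.
have thM k j : th (k + j * q)%N = th k.
  elim: j => [|j IH]; first by rewrite mul0n addn0.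
  by rewrite mulSn addnCA addnC thD IH.
have [k _ hk] : exists2 k : 'I_q, true & forall j : 'I_q, th j <= th k.
  case: (@arg_maxP _ R 'I_q (Ordinal q_gt0) xpredT th isT) => k _ hk.
  by exists k => // j; exact: hk.
exists k => m.
(* This inequality says that the window sum is at least m a, hence at least its ceiling. *)
have : th (m + k)%N <= th k.
  rewrite (divn_eq (m + k) q) addnC thM.
  exact: (hk (Ordinal (ltn_pmod (m + k) q_gt0))).
rewrite /th natrD mulrDl => h.
by rewrite /ceil_mul ceil_le_int rmorphB/=; lra.
Qed.

(** For rational slope some orbit point has all its window sums maximal and so equals U(b). As [z]
    bounds its orbit and is itself at most U(b), equality follows. *)
Lemma periodic_orbit_max b rho x z s : 0 <= b <= 1 -> rational b ->
  balanced b rho s -> z = r s -> z < 1 -> orbit_between x z ->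
  z = upper_value b.
Proof.
move=> hb qb /balanced_rounded[g hg ->] zE z1 oz.
have z_win : z = r (fun m => rounded g b rho (m + 0)%N - rounded g b rho 0).
  rewrite zE -r_window_shift; last exact: growth_rounded.
  by apply: r_eq => n; rewrite addn0.
have /andP[zl zu] := window_value_bounds rho 0 hg hb.
rewrite -z_win in zl zu.
apply/eqP; rewrite eq_le zu/=.
(* Slope 1 would give z >= L(1) = 1. *)
have b1 : b < 1.
  have /andP[_] := hb; rewrite le_eqVlt => /predU1P[b1|//].
  by move: zl z1; rewrite b1 lower_value1; lra.
have [k hk] := rounded_max_window rho hg qb.
have wE : r (fun m => rounded g b rho (m + k)%N - rounded g b rho k)
    = upper_value b.
  apply: r_eq => m; apply/eqP; rewrite eq_le hk.
  by have /andP[_ ->] := rounded_window b rho k m hg.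
have hb1 : 0 <= b < 1 by have /andP[-> _] := hb.
have /andP[_] := oz k; rewrite (fracpart_window hg hb zE) wE//.
rewrite upper_value_lt1// (le_trans (lower_value_ge0 hb))//.
exact: lower_le_upper_value.
Qed.

(** The digits have period [q], so 2^q U(a) differs from U(a) by an integer. *)
Lemma upper_value_rational a : 0 <= a <= 1 -> rational a ->
  rational (upper_value a).
Proof.
move=> ha /rational_mul_int[q [p [q0 aE]]].
have [gD _] := rounding_ceil.
have per n : ceil_mul a (n + q) = ceil_mul a n + p.
  by rewrite /ceil_mul natrD mulrDl aE gD.
have gr : linear_growth (upper a 0).
  rewrite upper0E; apply: linear_growthB; last exact: growth_ceil_mul.
  exact: linear_growth_shift1 (growth_ceil_mul ha).
have [n] := r_mul_exp2 R q gr.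
have -> : r (fun m => upper a 0 (m + q)%N) = r (upper a 0) :> R.
  by apply: r_eq => m; rewrite upper0E -addSn !per; lia.
rewrite r_upper0// => h; apply/rationalP; exists n, (2 ^ q - 1)%N.
have q2 : (1 < 2 ^ q)%N by rewrite -{1}(expn0 2) ltn_exp2l.
rewrite natrB ?(ltnW q2)// natrX.
have d0 : (2 ^+ q - 1 : R) != 0 by rewrite subr_eq0 -natrX pnatr_eq1 gtn_eqF.
by apply: (mulIf d0); rewrite mulfVK// mulrBr mulr1 h; ring.
Qed.

End Rounding.

(** * Digit windows and their extremal positions *)

Section Windows.
Variable R : realType.

Lemma window_iter (N : nat -> int) (m : nat) (c : int) :
  (forall i, N (i + m)%N - N i <= c) ->
  forall k i : nat, N (i + k * m)%N - N i <= k%:Z * c.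
Proof.
move=> h; elim=> [|k IH] i; first by rewrite mul0n addn0 subrr mul0r.
have := IH i; have := h (i + k * m)%N.
have -> : (i + k * m + m = i + k.+1 * m)%N by lia.
by lia.
Qed.

(** Windows are ordered like the points [z], so of two positions the one with the smaller point
    inherits both bounds. One position thus serves all lengths below [M]. *)
Lemma extremal_window (B : nat -> nat -> int) (f : nat -> int) (z : nat -> R) :
  (forall i j m, z i <= z j -> B i m <= B j m) ->
  (forall m, exists i, B i m <= f m) ->
  forall M, exists i, forall m, (m < M)%N -> B i m <= f m.
Proof.
move=> Bz Bf; elim=> [|M [i hi]]; first by exists 0%N.
have [j hj] := Bf M; case: (leP (z i) (z j)) => [ij|/ltW ji].
  exists i => m; rewrite ltnS leq_eqVlt => /predU1P[->|/hi//].
  exact: le_trans (Bz _ _ _ ij) hj.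
exists j => m; rewrite ltnS leq_eqVlt => /predU1P[->//|/hi].
exact: le_trans (Bz _ _ _ ji).
Qed.

End Windows.

(** * Optimality of U(a) and existence of the slope *)

Section Optimality.
Variable R : realType.
Implicit Types (a x y xi : R).

Lemma fracpart_bounds y : 0 <= fracpart y < 1.
Proof. by rewrite /fracpart; have := floor_bounds y; lra. Qed.

Lemma fracpart_double y (d := Num.floor (2 * fracpart y)) :
  0 <= d <= 1 /\ fracpart (2 * y) = 2 * fracpart y - d%:~R.
Proof.
have h := fracpart_bounds y; have /andP[h1 h2] := floor_bounds (2 * fracpart y).
split.
  apply/andP; split; last rewrite -ltzD1 -(ltr_int R).
    by apply: le_of_lt_intD1; move: h1 h2; rewrite -/d; lra.
  by move: h1 h2; rewrite -/d rmorphD/=; lra.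
rewrite (_ : 2 * y = (2 * Num.floor y + d)%:~R + (2 * fracpart y - d%:~R)).
  by rewrite fracpart_intD//; move: h1 h2; rewrite -/d; lra.
by rewrite rmorphD rmorphM/= /fracpart; lra.
Qed.

(* If the orbit has width less than 1/2, doubling preserves its cyclic order:
   orbit points and their digit windows are ordered alike. *)
Lemma admissible_ge a x y : 0 < a <= 1 -> upper_value a - 2^-1 <= x ->
  admissible x y -> upper_value a <= y.
Proof.
move=> /andP[a0 a1] ax [_ [xi _ xiP]]; rewrite leNgt; apply/negP => ya.
have ha : 0 <= a <= 1 by rewrite a1 ltW.
pose z n := fracpart (xi * 2 ^+ n).
have z01 n : 0 <= z n < 1 by exact: fracpart_bounds.
have zxy n : x <= z n <= y by exact: xiP.
(* This follows from y < U(a) <= x + 1/2. *)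
have width i j : z i < z j + 2^-1.
  by have := zxy i; have := zxy j; lra.
pose d n := Num.floor (2 * z n).
have dP n : 0 <= d n <= 1 /\ z n.+1 = 2 * z n - (d n)%:~R.
  by rewrite /d /z exprS mulrCA; exact: fracpart_double.
pose N n := \sum_(k < n) d k.
have NS n : N n.+1 = N n + d n by rewrite /N big_ord_recr.
pose A i m := N (i + m)%N - N i.
have AS i m : A i m.+1 = A i m + d (i + m)%N by rewrite /A addnS NS; lia.
have ASR i m : (A i m.+1)%:~R = (A i m)%:~R + (d (i + m)%N)%:~R :> R.
  by rewrite AS rmorphD.
have A0 i : A i 0 = 0 by rewrite /A addn0 subrr.
have Abound i m : 0 <= A i m <= m%:Z.
  by elim: m => [|m]; rewrite ?A0// AS; have [] := dP (i + m)%N; lia.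
have Anorm i m : `|A i m| <= (1 * m.+1)%:Z by have := Abound i m; lia.
(* X_m = z(i+m) + A i m satisfies X_{m+1} = 2 X_m - A i m, which identifies [z i] with the value of
   its digit sums. *)
have zE i : z i = r (A i).
  rewrite (@r_recurrence _ 2 (A i) (fun m => z (i + m)%N + (A i m)%:~R)).
  - by rewrite addn0 A0 addr0.
  - by exists 1%N.
  - by move=> m; rewrite addnS ASR; have [_ ->] := dP (i + m)%N; ring.
  - move=> m; have := z01 (i + m)%N; have := Abound i m.
    rewrite -(ler_int R) -(ler_int R (A i m)) -pmulrn => /andP[h1 h2] /andP[h3 h4].
    have m0 : (0 : R) <= m%:R by [].
    have -> : (2 * m.+1)%:R = 2 * m%:R + 2 :> R by rewrite mulnS natrD natrM addrC.
    by rewrite ger0_norm; lra.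
(* If the sums agree, the order passes to [z (i + m)] and [z (j + m)] and survives doubling. If they
   differ, they do so by at least 1, which exceeds 2 (z (i + m) - z (j + m)). *)
have zA i j m : z i <= z j ->
    z (i + m)%N + (A i m)%:~R <= z (j + m)%N + (A j m)%:~R.
  move=> ij; elim: m => [|m IH]; first by rewrite !addn0 !A0 lerD2r.
  rewrite !addnS !ASR.
  have [_ ->] := dP (i + m)%N; have [_ ->] := dP (j + m)%N.
  have w1 := width (i + m)%N (j + m)%N; have w2 := width (j + m)%N (i + m)%N.
  have [e|ne] := eqVneq (A i m) (A j m).
    by move: IH; rewrite e; lra.
  have : A i m + 1 <= A j m.
    rewrite lezD1 lt_neqAle ne/=; apply: (@le_of_lt_intD1 R).
    by move: w1 w2 IH; lra.
  by rewrite -(ler_int R) rmorphD/=; lra.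
have Ale i j m : z i <= z j -> A i m <= A j m.
  move=> /(zA i j m) h; apply: (@le_of_lt_intD1 R).
  by have := width (j + m)%N (i + m)%N; lra.
(* Otherwise every window of length [m] has sum at most c = ceil(m a) - 1, and the digits have
   density at most b = c/m < a. *)
have big m : exists i, ceil_mul a m <= A i m.
  case: (pselect (exists i, ceil_mul a m <= A i m)) => // nex; exfalso.
  have m0 : (0 < m)%N.
    by rewrite lt0n; apply/eqP => m0; apply: nex; exists 0%N; rewrite m0 A0 ceil_mul0.
  pose c := ceil_mul a m - 1.
  have Ac i : A i m <= c.
    by rewrite /c lerBrDr lezD1 ltNge; apply/negP => h; apply: nex; exists i.
  have c0 : 0 <= c by have := Ac 0%N; have := Abound 0%N m; lia.
  have mR : (0 : R) < m%:R by rewrite ltr0n.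
  pose b : R := c%:~R / m%:R.
  have mb : m%:R * b = c%:~R by rewrite mulrCA divff ?gt_eqF// mulr1.
  have b0 : 0 <= b by rewrite divr_ge0 ?ler0z// ltW.
  have ba : b < a.
    rewrite -(ltr_pM2l mR) mb /c rmorphB/=.
    by have /andP[] := ceil_bounds (m%:R * a).
  have hb : 0 <= b <= 1 by rewrite b0 (le_trans (ltW ba)).
  (* A stretch of length l m is counted twice: as [m] windows of length [l], each of sum greater
     than l b, and as [l] windows of length [m], each of sum at most c = m b. *)
  have small l : exists i, A i l <= floor_mul b l.
    case: (pselect (exists i, A i l <= floor_mul b l)) => // nex'; exfalso.
    have Al i : - N (i + l)%N - - N i <= - (floor_mul b l + 1).
      have : ~~ (A i l <= floor_mul b l) by apply/negP => h; apply: nex'; exists i.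
      by rewrite /A; lia.
    have := window_iter Al m 0; have := window_iter Ac l 0.
    rewrite mulnC => h1 h2.
    have h3 : m%:Z * (floor_mul b l + 1) <= l%:Z * c by lia.
    have /andP[_] := floor_bounds (l%:R * b); rewrite -/(floor_mul b l).
    rewrite -(ltr_pM2l mR) mulrCA mb => h4.
    move: h3; rewrite -(ler_int R) !rmorphM rmorphD/= -!pmulrn.
    by rewrite leNgt h4.
  (* Orbit points whose digit sums stay below floor(l b) for l < M push [x] down to L(b), which is
     less than U(a) - 1/2. *)
  have lim : x <= lower_value b.
    apply: (@le_r_lim _ 1); first by move=> n; exact: norm_floor_mul.
    move=> M; have [i hi] := extremal_window Ale small M.
    exists (A i); split => //; rewrite -zE.
    by have /andP[] := zxy i.
  by have := lower_lt_upper b0 ba a1; move: ax lim; lra.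
(* [extremal_window] bounds windows from above; negation yields a position whose windows reach
   ceil(m a) for all m < M. *)
have AleN i j m : - z i <= - z j -> - A i m <= - A j m.
  by rewrite !lerN2; exact: Ale.
have bigN m : exists i, - A i m <= - ceil_mul a m.
  by have [i hi] := big m; exists i; rewrite lerN2.
have : upper_value a <= y.
  apply: (@r_lim_le _ 1); first by move=> n; exact: norm_ceil_mul.
  move=> M; have [i hi] := extremal_window AleN bigN M.
  exists (A i); split => //; last by rewrite -zE; have /andP[] := zxy i.
  by move=> m /hi; rewrite lerN2.
by rewrite leNgt ya.
Qed.

(** U(a) itself serves as [xi] and as [y], so the infimum is attained. *)
Lemma F_upper_value a x : 0 < a < 1 ->
  upper_value a - 2^-1 <= x <= lower_value a -> F x = upper_value a.
Proof.
move=> /andP[a0 a1] /andP[ax xa].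
have ha : 0 <= a <= 1 by rewrite !ltW.
have adm : admissible x (upper_value a).
  have U0 : 0 < upper_value a by apply: upper_value_gt0; rewrite a0 ltW.
  have U1 : upper_value a < 1 by apply: upper_value_lt1; rewrite a1 ltW.
  split; first by rewrite !ltW.
  exists (upper_value a) => //.
  by apply: orbit_upper_value => //; rewrite a1 ltW.
have lbd : lbound (admissible x) (upper_value a).
  by move=> y; apply: admissible_ge => //; rewrite a0 ltW.
rewrite /F; case: pselect => [ne|/(_ (ex_intro _ _ adm))//].
apply/eqP; rewrite eq_le lb_le_inf// andbT ge_inf//.
by exists (upper_value a).
Qed.

(** Gives one perturbation [e] of a slope that keeps its first [M] multiples on the same side of the
    neighbouring integers. *)
Lemma small_multiples (delta : nat -> R) (M : nat) : (forall m, 0 < delta m) ->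
  exists2 e : R, 0 < e & forall m, (m < M)%N -> m%:R * e < delta m.
Proof.
move=> d0; elim: M => [|M [e e0 he]]; first by exists 1.
exists (Num.min e (delta M / M.+1%:R)).
  by rewrite lt_min e0 divr_gt0// ltr0n.
move=> m; rewrite ltnS leq_eqVlt => /predU1P[->|mM].
  apply: (@le_lt_trans _ _ (M%:R * (delta M / M.+1%:R))).
    by rewrite ler_wpM2l// ge_min lexx orbT.
  rewrite mulrCA gtr_pMr// ltr_pdivrMr ?ltr0n// mul1r ltr_nat//.
by apply: le_lt_trans (he m mM); rewrite ler_wpM2l// ge_min lexx.
Qed.

(** The slope is the supremum of all [b] with L(b) <= x; the two bounds come from slopes just above
    and just below it. *)
Lemma slope_exists x : 0 < x < 2^-1 ->
  exists2 a, 0 < a < 1 & upper_value a - 2^-1 <= x <= lower_value a.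
Proof.
move=> /andP[x0 x1]; pose S := [set b : R | 0 <= b <= 1 /\ lower_value b <= x].
have S0 : S 0 by split; rewrite ?lower_value0 ?lexx ?ler01// ltW.
have Sub : has_ubound S by exists 1 => b [/andP[]].
have Ssup : has_sup S by split => //; exists 0.
pose a := sup S.
have a0 : 0 <= a by exact: ub_le_sup.
have a1 : a <= 1 by apply: ge_sup; [exists 0 | move=> b [/andP[]]].
have ha : 0 <= a <= 1 by rewrite a0.
(* A slope [b] slightly above [a] has floor(m b) <= floor(m a) for m < M, and L(b) > x since [b] is
   outside [S]. *)
have xa : a < 1 -> x <= lower_value a.
  move=> lta1; apply: (@le_r_lim _ 1); first by move=> n; exact: norm_floor_mul.
  move=> M.
  have d0 m : 0 < (floor_mul a m)%:~R + 1 - m%:R * a.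
    by rewrite subr_gt0; have /andP[] := floor_bounds (m%:R * a).
  have [e e0 he] := small_multiples M d0.
  pose b := Num.min (a + e) 1.
  have ab : a < b by rewrite lt_min lta1 andbT ltrDl.
  have hb : 0 <= b <= 1 by rewrite (le_trans a0 (ltW ab))/= ge_min lexx orbT.
  exists (floor_mul b); split => [n|m mM|]; first exact: norm_floor_mul.
    apply: (@le_of_lt_intD1 R); have /andP[h1 _] := floor_bounds (m%:R * b).
    apply: (le_lt_trans h1); apply: (@le_lt_trans _ _ (m%:R * (a + e))).
      by rewrite ler_wpM2l// ge_min lexx.
    by have := he m mM; rewrite mulrDr; lra.
  rewrite leNgt; apply/negP => /ltW bx; have : b <= a by exact: ub_le_sup.
  by rewrite leNgt ab.
(* A slope [b] of [S] with b > a - e has floor(m b) >= ceil(m a) - 1 for 0 < m < M. *)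
have ax : 0 < a -> upper_value a - 2^-1 <= x.
  move=> lt0a; rewrite upper_value_sub_half//.
  apply: (@r_lim_le _ 2).
    by move=> n; have := norm_ceil_mul n ha; lia.
  move=> M.
  have d0 m : 0 < m%:R * a - ((ceil_mul a m)%:~R - 1).
    by rewrite subr_gt0; have /andP[] := ceil_bounds (m%:R * a).
  have [e e0 he] := small_multiples M d0.
  have [b [hb bx] ab] := sup_adherent e0 Ssup.
  exists (floor_mul b); split => // [n|m mM].
    by have := norm_floor_mul n hb; lia.
  case: m mM => [|m] mM; first by rewrite ceil_mul0 floor_mul0.
  rewrite /floor_mul floor_ge_int rmorphB/= -/(ceil_mul a m.+1).
  apply: (@le_trans _ _ (m.+1%:R * (a - e))).
    by have := he _ mM; rewrite mulrBr; lra.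
  by rewrite ler_wpM2l// ltW.
(* a = 0 would give x <= L(0) = 0, and a = 1 would give x >= U(1) - 1/2 = 1/2. *)
have lt0a : 0 < a.
  rewrite lt_neqAle a0 andbT; apply/negP => /eqP e0.
  by have := xa; rewrite -e0 lower_value0; lra.
have lta1 : a < 1.
  rewrite lt_neqAle a1 andbT; apply/negP => /eqP e1.
  by have := ax lt0a; rewrite e1 upper_value1; lra.
by exists a; rewrite ?lt0a// ax// xa.
Qed.

End Optimality.

(** * The value of [F] by type of expansion *)

Section Cases.
Variable R : realType.
Implicit Types (a b x y z : R) (p q : nat).

(** On an orbit in [1/2, 1) every digit is 1 and the distance to 1 doubles forever. So the
    admissible set is empty and [F] takes its default value 1. *)
Lemma F_ge_half x : 2^-1 <= x -> F x = 1.
Proof.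
move=> x2; rewrite /F; case: pselect => // ne; exfalso.
case: ne => y [_ [xi _ xiP]].
pose z n := fracpart (xi * 2 ^+ n).
have z1 n : z n < 1 by have /andP[] := fracpart_bounds (xi * 2 ^+ n).
have z2 n : 2^-1 <= z n by have /andP[h _] := xiP n; exact: le_trans h.
have zS n : 1 - z n.+1 = 2 * (1 - z n).
  have [/andP[_]] := fracpart_double (xi * 2 ^+ n).
  rewrite mulrCA -exprS -/(z n) -/(z n.+1) => d1 e.
  have : 1 <= Num.floor (2 * z n) by rewrite floor_ge_int; have := z2 n; lra.
  move=> d2; have d : Num.floor (2 * z n) = 1 by apply: le_anti; rewrite d1.
  by rewrite e d; lra.
have : 1 - z 0%N <= 0.
  apply: (@le0_of_exp_bound _ 1) => M.
  have -> : (1 - z 0%N) * 2 ^+ M = 1 - z M.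
    elim: M => [|M IH]; first by rewrite expr0 mulr1.
    by rewrite zS -IH exprS mulrCA.
  have : (1 : R) <= (1 * M.+1)%:R by rewrite mul1n ler1n.
  by have := z2 M; lra.
by have := z1 0%N; lra.
Qed.

Lemma F0 : F (0 : R) = 0.
Proof.
have adm : admissible (0 : R) 0.
  split; first by rewrite lexx ler01.
  exists 1 => // n; rewrite mul1r -[_ ^+ n]addr0 -natrX pmulrn.
  by rewrite fracpart_intD ?lexx ?ltr01.
have lbd : lbound (admissible (0 : R)) 0 by move=> y [/andP[y0 _] _].
rewrite /F; case: pselect => [ne|/(_ (ex_intro _ _ adm))//].
apply/eqP; rewrite eq_le lb_le_inf// andbT ge_inf//.
by exists 0.
Qed.

Lemma irrational_interior a : 0 <= a <= 1 -> irrational a -> 0 < a < 1.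
Proof.
move=> /andP[a0 a1] ia; rewrite !lt_neqAle a0 a1 !andbT.
apply/andP; split; apply/negP => /eqP e; apply: ia; apply/rationalP.
  by exists 0, 1%N; rewrite -e mul0r.
by exists 1, 1%N; rewrite e divr1.
Qed.

(** The interval [U(a) - 1/2, L(a)] is the single point [x]. A competitor [z] is admissible for [x],
    so z >= U(a) = x + 1/2. *)
Lemma irrational_case x : x <= 2^-1 -> expansion_in (char_sturmian R) (2 * x) ->
  F x = x + 2^-1
  /\ unique (fun z : R => [/\ 0 <= z <= 1, expansion_in (sturmian R) z,
                              orbit_between x z & z <= x + 2^-1]) (F x).
Proof.
move=> x2 [s [a [ha ia sa]] xE].
have /andP[a0 a1] := irrational_interior ha ia.
have UL := upper_eq_lower_irrational ha ia.
have xL : x = lower_value a.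
  case: sa xE => ->.
    by rewrite r_lower_char ?(ltW a0)//; lra.
  by rewrite r_upper_char ?a0 ?(ltW a1)//; lra.
have FU : F x = upper_value a.
  by apply: F_upper_value; rewrite ?a0// UL xL lexx.
have FE : F x = x + 2^-1 by rewrite FU xL; lra.
have x0 : 0 < x.
  have := lower_lt_upper (lexx 0) a0 (ltW a1).
  by rewrite lower_value0 UL -xL.
split=> //; split.
  split; last by rewrite FE.
  - by rewrite FE; lra.
  - exists (upper a 0); last by rewrite r_upper0.
    by exists a, 0; split => //; [rewrite lexx ler01|right].
  - by rewrite FU; apply: orbit_upper_value; rewrite ?a1 ?(ltW a0)// xL.
move=> z [z01 _ oz zx]; apply/eqP; rewrite eq_le FE zx andbT -FE FU.
apply: (@admissible_ge _ _ x); first by rewrite a0 ltW.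
  by rewrite UL xL.
split=> //; exists z => //; rewrite lt_neqAle; apply/andP; split; last by have /andP[] := z01.
apply/negP => /eqP z0; have /andP[] := oz 0%N.
by rewrite -z0 mul0r -[0]add0r -[X in fracpart (X + _)]/(0%:~R) fracpart_intD ?lexx ?ltr01//; lra.
Qed.

(** A competitor equals U(b) for its slope [b] and is admissible, hence at least U(a). The case b >
    a is excluded because U(b) - 1/2 > L(a) >= x. *)
Lemma rational_case a x : 0 < a < 1 -> rational a ->
  upper_value a - 2^-1 <= x <= lower_value a ->
  unique (fun z : R => [/\ 0 < z < 1, expansion_in (periodic_balanced R) z,
                           orbit_between x z & z <= x + 2^-1]) (upper_value a).
Proof.
move=> /andP[a0 a1] qa /andP[ax xa].
have ha : 0 <= a <= 1 by rewrite !ltW.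
split.
  split.
  - by rewrite upper_value_gt0 ?upper_value_lt1// ?a0 ?a1 ltW.
  - exists (upper a 0); last by rewrite r_upper0.
    by exists a, 0; split => //; [rewrite lexx ler01|right].
  - by apply: orbit_upper_value; rewrite ?a1 ?(ltW a0).
  - by move: ax; lra.
move=> z [/andP[z0 z1] [s [b [rho [hb _ qb sb]]] zE] oz zx].
have zU := periodic_orbit_max hb qb sb zE z1 oz.
apply/eqP; rewrite eq_le; apply/andP; split.
  apply: (@admissible_ge _ _ x) => //; first by rewrite a0 ltW.
  by split; [rewrite !ltW|exists z].
have /andP[b0 b1] := hb.
rewrite zU; apply: upper_value_mono => //; last exact: ltW.
rewrite leNgt; apply/negP => ab.
have := lower_lt_upper (ltW a0) ab b1; move: zx xa; rewrite zU; lra.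
Qed.

Lemma coprime_slope_itv p q : coprime_slope p q -> 0 < (p%:R / q%:R : R) < 1.
Proof.
move=> [/andP[p0 pq] _]; have q0 : (0 : R) < q%:R by rewrite ltr0n (ltn_trans p0).
apply/andP; split; first by rewrite divr_gt0// ltr0n.
by rewrite ltr_pdivrMr// mul1r ltr_nat.
Qed.

Lemma rational_slope p q : rational (p%:R / q%:R : R).
Proof. by apply/rationalP; exists p, q. Qed.

Lemma rational_coprime_slope a : 0 < a < 1 -> rational a ->
  exists p q, coprime_slope p q /\ a = p%:R / q%:R.
Proof.
move=> /andP[a0 a1] /rational_mul_int[Q [P [Q0 aE]]].
have QR : (0 : R) < Q%:R by rewrite ltr0n.
have P0 : 0 < P by rewrite -(ltr0z R) -aE mulr_gt0.
have PQ : P < Q%:Z by rewrite -(ltr_int R) -aE -pmulrn -[ltRHS]mulr1 ltr_pM2l.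
case: P P0 PQ aE => // P P0 PQ aE.
pose g := gcdn P Q; have g0 : (0 < g)%N by rewrite gcdn_gt0 Q0 orbT.
have eP : (P %/ g * g = P)%N by rewrite divnK// dvdn_gcdl.
have eQ : (Q %/ g * g = Q)%N by rewrite divnK// dvdn_gcdr.
exists (P %/ g)%N, (Q %/ g)%N; split; first split.
- rewrite divn_gt0// dvdn_leq ?dvdn_gcdl//=.
  by rewrite -(ltn_pmul2r g0) eP eQ.
- by rewrite /coprime -(eqn_pmul2r g0) muln_gcdl eP eQ mul1n.
- have gR : (g%:R : R) != 0 by rewrite pnatr_eq0 -lt0n.
  have qR : ((Q %/ g)%:R : R) != 0.
    by rewrite pnatr_eq0; apply: contraTneq Q0 => e; rewrite -eQ e.
  apply: (mulIf qR); apply: (mulIf gR).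
  by rewrite mulfVK// -mulrA -!natrM eP eQ mulrC aE pmulrn.
Qed.

Lemma coprime_slope_inj p q p' q' : coprime_slope p q -> coprime_slope p' q' ->
  p%:R / q%:R = p'%:R / q'%:R :> R -> (p, q) = (p', q').
Proof.
move=> [/andP[p0 pq] cpq] [/andP[p'0 p'q'] cpq'] /eqP.
have q0 := ltn_trans p0 pq; have q'0 := ltn_trans p'0 p'q'.
rewrite eqr_div ?pnatr_eq0 -?lt0n// -!natrM eqr_nat => /eqP e.
have qq : q = q'.
  apply/eqP; rewrite eqn_dvd; apply/andP; split.
    by rewrite -(@Gauss_dvdr _ p) 1?coprime_sym// e dvdn_mull.
  by rewrite -(@Gauss_dvdr _ p') 1?coprime_sym// -e dvdn_mull.
by move: e; rewrite qq => /eqP; rewrite eqn_pmul2r// => /eqP ->.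
Qed.

(** Dropping the first digit rotates the period, which turns (0w1)^oo into (w10)^oo and (1w0)^oo
    into (w01)^oo. *)
Lemma word_omega_rcons (d : int) w n :
  word_omega (d :: w) n.+1 = word_omega (rcons w d) n.
Proof.
rewrite /word_omega/= size_rcons -addn1 -modnDml addn1 nth_rcons.
have := ltn_pmod n (ltn0Sn (size w)); rewrite ltnS leq_eqVlt.
case/predU1P => [->|lt_nw]; first by rewrite modnn ltnn eqxx.
by rewrite modn_small ?ltnS// lt_nw.
Qed.

Lemma r_central_lower p q : coprime_slope p q ->
  r (word_omega (central_word R p q ++ [:: 1; 0])) = 2 * lower_value (p%:R / q%:R : R).
Proof.
move=> pq; have [_ _ lE _] := central_wordP R pq.
have /andP[a0 a1] := coprime_slope_itv pq.
rewrite -r_lower_char ?a1 ?ltW//; apply: r_eq => n.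
by rewrite -lowerS lE word_omega_rcons -cats1 -catA.
Qed.

Lemma r_central_upper p q : coprime_slope p q ->
  r (word_omega (central_word R p q ++ [:: 0; 1])) = 2 * upper_value (p%:R / q%:R : R) - 1.
Proof.
move=> pq; have [_ _ _ uE] := central_wordP R pq.
have /andP[a0 a1] := coprime_slope_itv pq.
rewrite -r_upper_char ?a0 ?ltW//; apply: r_eq => n.
by rewrite -upperS uE word_omega_rcons -cats1 -catA.
Qed.

Lemma r_central_max p q : coprime_slope p q ->
  r (word_omega (1 :: central_word R p q ++ [:: 0])) = upper_value (p%:R / q%:R : R).
Proof.
move=> pq; have [_ _ _ uE] := central_wordP R pq.
have /andP[a0 a1] := coprime_slope_itv pq.
by rewrite -r_upper0 ?uE// !ltW.
Qed.

End Cases.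

(** * Assembly of the cases *)

(** If [a] is the slope belonging to [x], then U(b) for a < b < 1 also satisfies [orbit_between x];
    the bound [z <= x + 2^-1] excludes these values. No interval contains 2x = 1, so the point 1/2
    is listed apart. *)
Theorem theorem1p7 (R : realType) (x : R) (hx : 0 <= x <= 1) :
  (* (i), and the boundary point 1/2 *)
  (2^-1 < x -> F x = 1)
  /\ (x = 2^-1 -> F x = 1)
  (* (ii) *)
  /\ (x = 0 -> F x = 0)
  (* (iii) *)
  /\ (x <= 2^-1 -> expansion_in (char_sturmian R) (2 * x) ->
      F x = x + 2^-1
      /\ unique (fun z : R => [/\ 0 <= z <= 1, expansion_in (sturmian R) z,
                                  orbit_between x z & z <= x + 2^-1]) (F x))
  (* (iv) *)
  /\ (forall p q : nat, coprime_slope p q ->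
      x <= 2^-1 -> expansion_in (char_periodic_balanced R p q) (2 * x) ->
      [/\ rational (F x),
          F x = r (word_omega (1 :: central_word R p q ++ [:: 0])),
          F x = r (upper (p%:R / q%:R : R) 0),
          F x <= x + 2^-1
        & unique (fun z : R => [/\ 0 < z < 1,
                                   expansion_in (periodic_balanced R) z,
                                   orbit_between x z & z <= x + 2^-1]) (F x)])
  (* (v) *)
  /\ (0 < x < 2^-1 ->
      ~ expansion_in (char_sturmian R) (2 * x) ->
      (forall p q : nat, coprime_slope p q ->
         ~ expansion_in (char_periodic_balanced R p q) (2 * x)) ->
      exists p q : nat,
        unique (fun pq : nat * nat =>
          [/\ coprime_slope pq.1 pq.2,
              r (word_omega (central_word R pq.1 pq.2 ++ [:: 0; 1])) < 2 * x
            & 2 * x < r (word_omega (central_word R pq.1 pq.2 ++ [:: 1; 0]))])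
          (p, q)
        /\ [/\ rational (F x),
               F x = r (word_omega (1 :: central_word R p q ++ [:: 0])),
               F x < x + 2^-1
             & unique (fun z : R => [/\ 0 < z < 1,
                                   expansion_in (periodic_balanced R) z,
                                   orbit_between x z & z <= x + 2^-1]) (F x)]).
Proof.
split; first by move=> x2; exact: F_ge_half (ltW x2).
split; first by move=> x2; apply: F_ge_half; rewrite x2.
split; first by move=> ->; exact: F0.
split; first exact: irrational_case.
split=> [p q pq _ [s sE xE]|x02 nsturm nper].
  have itv := coprime_slope_itv R pq; have /andP[a0 a1] := itv.
  have ha : 0 <= (p%:R / q%:R : R) <= 1 by rewrite !ltW.
  set a : R := p%:R / q%:R in itv a0 a1 ha sE *.
  have aL := upper_le_lower ha.
  have hxa : upper_value a - 2^-1 <= x <= lower_value a.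
    (* The two characteristic sequences put [x] at the two ends of the interval. *)
    case: sE xE => ->.
      by rewrite r_lower_char ?(ltW a0)//; lra.
    by rewrite r_upper_char ?a0 ?(ltW a1)//; lra.
  have qa : rational a by exact: rational_slope.
  rewrite (F_upper_value itv hxa) r_central_max// r_upper0//; split => //.
  - exact: upper_value_rational.
  - by have /andP[] := hxa; lra.
  - exact: rational_case.
have [a itv hxa] := slope_exists x02; have /andP[a0 a1] := itv.
have ha : 0 <= a <= 1 by rewrite !ltW.
(* For irrational [a] the interval is a point, so 2x = 2 L(a) would have a characteristic Sturmian
   expansion. *)
have qa : rational a.
  apply: contrapT => ia; apply: nsturm; exists (lower a a).
    by exists a; split => //; left.
  rewrite r_lower_char ?(ltW a0)//.
  by have := upper_eq_lower_irrational ha ia; move: hxa; lra.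
have [p [q [pq aE]]] := rational_coprime_slope itv qa.
(* At an end of the interval, 2x would have a characteristic periodic balanced expansion. *)
have hlt : upper_value a - 2^-1 < x < lower_value a.
  move: hxa => /andP[h1 h2]; rewrite !lt_neqAle h1 h2 !andbT.
  apply/andP; split; apply/negP => /eqP e; apply: (nper p q pq).
    exists (upper a a); first by rewrite aE; right.
    by rewrite r_upper_char ?a0 ?(ltW a1)// -e; lra.
  exists (lower a a); first by rewrite aE; left.
  by rewrite r_lower_char ?(ltW a0)// e.
exists p, q; rewrite (F_upper_value itv hxa) r_central_max// -aE.
split; last first.
  split => //; first exact: upper_value_rational.
    by have /andP[] := hlt; lra.
  exact: rational_case.
split.
  by split => //=; rewrite ?r_central_lower ?r_central_upper// -aE; move: hlt; lra.
move=> [p' q'] /= [pq' h1 h2]; apply: (@coprime_slope_inj R) => //.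
rewrite -aE; move: h1 h2; rewrite r_central_lower// r_central_upper//.
have := coprime_slope_itv R pq'; set b : R := p'%:R / q'%:R => /andP[b0 b1] h1 h2.
move: hlt => /andP[h3 h4].
(* Distinct slopes have disjoint intervals, so they cannot both contain [x]. *)
case: (ltgtP a b) => // ab.
  by have := lower_lt_upper (ltW a0) ab (ltW b1); lra.
by have := lower_lt_upper (ltW b0) ab (ltW a1); lra.
Qed.
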